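(* Let $N\subset M$ be a submodule of a $\mathbb B$-module $M$, with inclusion $\iota:N\to M$, and let $F=M/N:\mathrm{Bmod}^2\to\mathrm{Bmod}$ be the functor $F(X)=\{(f,g)\mid f,g\in\mathrm{Hom}_{\mathbb B}(M,X),\ f|_N=g|_N\}$. Let $E=M\times M$ and $Q=E/\!\sim\ \simeq\mathrm{Coker}_p(\iota)$. (i) The involution $(x,y)\mapsto(y,x)$ on $E=M\times M$ induces an involution $\sigma$ on $Q\simeq\mathrm{Coker}_p(\iota)$ which turns $\mathrm{Coker}_p(\iota)$ into an object of $\mathrm{Bmod}^{\mathfrak s}$. (ii) The functor $F:\mathrm{Bmod}^2\to\mathrm{Bmod}$ associated to the quotient ``$M/N$'' is represented in the category $\mathrm{Bmod}^{\mathfrak s}$ by the object $\mathrm{Coker}_p(\iota:N\to M)=(Q=E/\!\sim,\sigma)$; i.e. there is an isomorphism $F(X)\simeq\mathrm{Hom}_{\mathrm{Bmod}^{\mathfrak s}}((Q,\sigma),y_{\mathbb B}(X))$, natural in the object $X$ of $\mathrm{Bmod}^2$.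
   Context: $\mathbb B=\{0,1\}$ is the Boolean semifield ($1+1=1$). A $\mathbb B$-module is a commutative monoid $(M,+,0)$ with $x+x=x$ for all $x$; morphisms are the monoid homomorphisms, added pointwise; the category is $\mathrm{Bmod}$. $\mathrm{Bmod}^2$ has $\mathbb B$-modules as objects, and morphisms $M\to N$ are pairs $(f,g)$ of morphisms in $\mathrm{Bmod}$, composed by $(f,g)\circ(f',g')=(f f'+g g',\,f g'+g f')$. $\mathrm{Bmod}^{\mathfrak s}$ is the category of $\mathbb B$-modules with an involution $\sigma$ (an endomorphism with $\sigma^2=\mathrm{id}$), with morphisms commuting with $\sigma$. $F$ acts on a morphism $\phi:X\to X'$ of $\mathrm{Bmod}^2$ by $(f,g)\mapsto\phi\circ(f,g)$ (composition in $\mathrm{Bmod}^2$), and $F(X)$ has pointwise addition. The functor $y_{\mathbb B}:\mathrm{Bmod}^2\to\mathrm{Bmod}^{\mathfrak s}$ sends $X$ to $X\times X$ with the involution $(x,y)\mapsto(y,x)$, and $(\alpha,\beta):X\to X'$ to $(x,y)\mapsto(\alpha(x)+\beta(y),\alpha(y)+\beta(x))$. The congruence $\sim$ on $E=M\times M$ is: $(x,y)\sim(x',y')$ iff $f(x)+g(y)=f(x')+g(y')$ for every $\mathbb B$-module $X$ and every $(f,g)\in F(X)$. The quotient $Q=E/\!\sim$ is the cokernel pair $\mathrm{Coker}_p(\iota)$, i.e. the coequalizer in $\mathrm{Bmod}$ of $s_1\circ\iota,s_2\circ\iota:N\to M\oplus M=M\times M$, with $s_1(x)=(x,0)$, $s_2(x)=(0,x)$.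 *)

(* Defs.v *)
From HB Require Import structures.
From mathcomp Require Import all_boot all_order all_algebra.
From mathcomp Require Import boolp.

Set Implicit Arguments.
Unset Strict Implicit.
Unset Printing Implicit Defensive.

Import GRing.Theory.
Local Open Scope ring_scope.
Local Open Scope quotient_scope.

#[local] Obligation Tactic := idtac.

Record category := Category {
  obj :> Type;
  mor : obj -> obj -> Type;
  idc : forall X, mor X X;
  compc : forall X Y Z, mor Y Z -> mor X Y -> mor X Z;
  comp_idl : forall X Y (f : mor X Y), compc (idc Y) f = f;
  comp_idr : forall X Y (f : mor X Y), compc f (idc X) = f;
  compA : forall X Y Z T (h : mor Z T) (g : mor Y Z) (f : mor X Y),
    compc h (compc g f) = compc (compc h g) f }.

Arguments idc {c} X.
Arguments compc {c X Y Z} g f : rename.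

Record functor (C D : category) := Functor {
  fobj :> C -> D;
  fmap : forall X Y : C, mor X Y -> mor (fobj X) (fobj Y);
  fmap_id : forall X : C, fmap (idc X) = idc (fobj X);
  fmap_comp : forall (X Y Z : C) (g : mor Y Z) (f : mor X Y),
    fmap (compc g f) = compc (fmap g) (fmap f) }.

Section CompFunctor.
Variables (C D E : category) (G : functor D E) (F : functor C D).

Let cmap (X Y : C) (f : mor X Y) : mor (G (F X)) (G (F Y)) := fmap G (fmap F f).

Lemma cmap_id X : cmap (idc X) = idc (G (F X)).
Proof. by rewrite /cmap !fmap_id. Qed.

Lemma cmap_comp X Y Z (g : mor Y Z) (f : mor X Y) :
  cmap (compc g f) = compc (cmap g) (cmap f).
Proof. by rewrite /cmap !fmap_comp. Qed.

Definition comp_functor : functor C E := Functor cmap_id cmap_comp.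
End CompFunctor.

Definition is_iso (C : category) (X Y : C) (f : mor X Y) : Prop :=
  exists g : mor Y X, compc g f = idc X /\ compc f g = idc Y.

Definition naturally_isomorphic (C D : category) (F G : functor C D) : Prop :=
  exists eta : forall X : C, mor (F X) (G X),
    (forall (X Y : C) (f : mor X Y),
       compc (fmap G f) (eta X) = compc (eta Y) (fmap F f)) /\
    (forall X : C, is_iso (eta X)).

Definition is_coequalizer (C : category) (X Y Q : C)
    (f g : mor X Y) (q : mor Y Q) : Prop :=
  compc q f = compc q g /\
  forall (Z : C) (h : mor Y Z), compc h f = compc h g ->
    exists! k : mor Q Z, compc k q = h.

HB.mixin Record Nmodule_isBModule M of GRing.Nmodule M := {
  addrr_idem : forall x : M, x + x = x }.

(* A module over the Boolean semifield is a commutative monoid in which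
   addition is idempotent; the linear maps are the monoid morphisms, that is
   [{additive M -> X}].  The choice operator carried by [nmodType] is no
   restriction, by [gen_choiceMixin]. *)
#[short(type="bmodType")]
HB.structure Definition BModule :=
  {M of GRing.Nmodule M & Nmodule_isBModule M}.

Lemma additive_eq (U V : baseAddUMagmaType) (f g : {additive U -> V}) :
  f =1 g -> f = g.
Proof.
case: f g => [f [[Pf]]] [g [[Pg]]] /= /funext fg.
by move: Pf Pg; rewrite fg => Pf Pg; rewrite (Prop_irrelevance Pf Pg).
Qed.

Section ProdBModule.
Variables X Y : bmodType.

Fact prod_addrr (p : X * Y) : p + p = p.
Proof. by case: p => x y; congr (_, _); exact: addrr_idem. Qed.

HB.instance Definition _ := Nmodule_isBModule.Build (X * Y)%type prod_addrr.
End ProdBModule.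

Section HomBModule.
Variables X Y : bmodType.
Implicit Types f g h : {additive X -> Y}.

HB.instance Definition _ := gen_eqMixin {additive X -> Y}.
HB.instance Definition _ := gen_choiceMixin {additive X -> Y}.

Definition hom_zero : {additive X -> Y} := \0%R.
Definition hom_add f g : {additive X -> Y} := f \+ g.

Fact hom_addA : associative hom_add.
Proof. by move=> f g h; apply: additive_eq => x /=; rewrite addrA. Qed.

Fact hom_addC : commutative hom_add.
Proof. by move=> f g; apply: additive_eq => x /=; rewrite addrC. Qed.

Fact hom_add0 : left_id hom_zero hom_add.
Proof. by move=> f; apply: additive_eq => x /=; rewrite add0r. Qed.

HB.instance Definition _ :=
  GRing.isNmodule.Build {additive X -> Y} hom_addA hom_addC hom_add0.

Fact hom_addrr f : f + f = f.
Proof. by apply: additive_eq => x; exact: addrr_idem. Qed.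

HB.instance Definition _ :=
  Nmodule_isBModule.Build {additive X -> Y} hom_addrr.

Lemma hom_addE f g x : (f + g) x = f x + g x. Proof. by []. Qed.
Lemma hom_0E x : (0 : {additive X -> Y}) x = 0. Proof. by []. Qed.
End HomBModule.

Definition hom_id (X : bmodType) : {additive X -> X} := idfun.
Definition hom_comp (X Y Z : bmodType)
  (g : {additive Y -> Z}) (f : {additive X -> Y}) : {additive X -> Z} := g \o f.

Program Definition Bmod : category := @Category bmodType
  (fun X Y => {additive X -> Y}) hom_id hom_comp _ _ _.
Next Obligation. by move=> *; apply: additive_eq. Qed.
Next Obligation. by move=> *; apply: additive_eq. Qed.
Next Obligation. by move=> *; apply: additive_eq. Qed.

Definition hom2 (X Y : bmodType) : Type :=
  ({additive X -> Y} * {additive X -> Y})%type.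

Definition hom2_comp (X Y Z : bmodType) (u : hom2 Y Z) (v : hom2 X Y) :
    hom2 X Z :=
  (hom_comp u.1 v.1 + hom_comp u.2 v.2, hom_comp u.1 v.2 + hom_comp u.2 v.1).

Program Definition Bmod2 : category := @Category bmodType hom2
  (fun X => (hom_id X, 0)) hom2_comp _ _ _.
Next Obligation.
by move=> X Y [f g]; congr (_, _); apply: additive_eq => x; exact: addr0.
Qed.
Next Obligation.
move=> X Y [f g]; congr (_, _); apply: additive_eq => x.
  by rewrite hom_addE /= [g 0]raddf0 addr0.
by rewrite hom_addE /= [f 0]raddf0 add0r.
Qed.
Next Obligation.
move=> X Y Z T [h h'] [g g'] [f f']; congr (_, _); apply: additive_eq => x;
  by rewrite !(hom_addE, raddfD) /= !(hom_addE, raddfD) [X in _ + X = _]addrC addrACA.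
Qed.

Record bmods := BmodS {
  bmods_sort :> bmodType;
  bmods_inv : {additive bmods_sort -> bmods_sort};
  bmods_invK : involutive bmods_inv }.

Section HomS.
Variables A B : bmods.

Definition equivariant : {pred {additive A -> B}} :=
  fun f => `[< forall x, f (bmods_inv A x) = bmods_inv B (f x) >].

Record homs := HomS { homs_val :> {additive A -> B}; _ : homs_val \in equivariant }.

HB.instance Definition _ := [isSub for homs_val].
HB.instance Definition _ := [Choice of homs by <:].

Lemma equivariantP (f : {additive A -> B}) :
  reflect (forall x, f (bmods_inv A x) = bmods_inv B (f x)) (f \in equivariant).
Proof. exact: asboolP. Qed.

Fact equivariant_closed : GRing.nmod_closed equivariant.
Proof.
split=> [|f g /equivariantP fP /equivariantP gP]; apply/equivariantP => x.
  by rewrite /= raddf0.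
by rewrite !hom_addE fP gP raddfD.
Qed.

HB.instance Definition _ :=
  GRing.SubChoice_isSubNmodule.Build _ _ homs equivariant_closed.

Fact homs_addrr (f : homs) : f + f = f.
Proof. by apply: val_inj; rewrite raddfD addrr_idem. Qed.

HB.instance Definition _ := Nmodule_isBModule.Build homs homs_addrr.

Lemma homs_eq (f g : homs) : f =1 g -> f = g.
Proof. by move=> fg; apply: val_inj; apply: additive_eq. Qed.

Lemma homs_equi (f : homs) x : f (bmods_inv A x) = bmods_inv B (f x).
Proof. by case: f => f /= /equivariantP. Qed.
End HomS.

Fact homs_id_subproof (A : bmods) : hom_id A \in @equivariant A A.
Proof. exact/equivariantP. Qed.
Definition homs_id (A : bmods) : homs A A := HomS (homs_id_subproof A).

Fact homs_comp_subproof (A B C : bmods) (g : homs B C) (f : homs A B) :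
  hom_comp g f \in @equivariant A C.
Proof. by apply/equivariantP => x /=; rewrite !homs_equi. Qed.
Definition homs_comp (A B C : bmods) (g : homs B C) (f : homs A B) : homs A C :=
  HomS (homs_comp_subproof g f).

Program Definition Bmods : category := @Category bmods homs homs_id homs_comp _ _ _.
Next Obligation. by move=> *; apply: homs_eq. Qed.
Next Obligation. by move=> *; apply: homs_eq. Qed.
Next Obligation. by move=> *; apply: homs_eq. Qed.

Section HomsFunctor.
Variable A : bmods.

Section Map.
Variables (B C : bmods) (g : homs B C).
Definition homs_post (f : homs A B) : homs A C := homs_comp g f.
Fact homs_post_nmod_morphism : GRing.nmod_morphism homs_post.
Proof.
split=> [|f f']; apply: homs_eq => x /=; first exact: raddf0.
exact: raddfD.
Qed.
HB.instance Definition _ :=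
  GRing.isNmodMorphism.Build _ _ homs_post homs_post_nmod_morphism.
End Map.

(* The covariant functor Hom(A, -) with values in B-modules under pointwise
   addition. *)
Program Definition homs_functor : functor Bmods Bmod := @Functor Bmods Bmod
  (fun B => homs A B : bmodType)
  (fun B C g => homs_post g : {additive homs A B -> homs A C}) _ _.
Next Obligation. by move=> B; apply: additive_eq => f; apply: homs_eq. Qed.
Next Obligation. by move=> B C D g f; apply: additive_eq => h; apply: homs_eq. Qed.
End HomsFunctor.

Section Swap.
Variable X : bmodType.
Definition flip (p : X * X) : X * X := (p.2, p.1).
Fact swap_nmod_morphism : GRing.nmod_morphism flip. Proof. by []. Qed.
HB.instance Definition _ := GRing.isNmodMorphism.Build _ _ flip swap_nmod_morphism.
Lemma swapK : involutive flip. Proof. by case. Qed.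
End Swap.

Definition yB_obj (X : bmodType) : bmods := @BmodS (X * X)%type (@flip X) (@swapK X).

Section YBMap.
Variables (X Y : bmodType) (u : hom2 X Y).
Definition yB_fun (p : X * X) : Y * Y :=
  (u.1 p.1 + u.2 p.2, u.1 p.2 + u.2 p.1).
Fact yB_fun_nmod_morphism : GRing.nmod_morphism yB_fun.
Proof.
split=> [|p q]; first by rewrite /yB_fun /= !raddf0 addr0.
by rewrite /yB_fun /= !raddfD; congr (_, _); rewrite addrACA.
Qed.
HB.instance Definition _ :=
  GRing.isNmodMorphism.Build _ _ yB_fun yB_fun_nmod_morphism.
Fact yB_subproof : (yB_fun : {additive _ -> _}) \in @equivariant (yB_obj X) (yB_obj Y).
Proof. exact/equivariantP. Qed.
Definition yB_map : homs (yB_obj X) (yB_obj Y) := HomS yB_subproof.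
End YBMap.

Program Definition yB : functor Bmod2 Bmods := @Functor Bmod2 Bmods yB_obj yB_map _ _.
Next Obligation.
by move=> X; apply: homs_eq => -[x y]; congr (_, _); exact: addr0.
Qed.
Next Obligation.
move=> X Y Z [g g'] [f f']; apply: homs_eq => -[x y].
rewrite /= /yB_fun /= !raddfD.
by congr (_, _); rewrite addrACA [X in _ + X = _]addrC.
Qed.

Section Quotient.
Variables (M : bmodType) (N : addrClosed M).

Record submod := Submod { submod_val : M; _ : submod_val \in N }.
HB.instance Definition _ := [isSub for submod_val].
HB.instance Definition _ := [Choice of submod by <:].
Fact submod_closed : GRing.nmod_closed N. Proof. exact: GRing.nmod_closed_subproof. Qed.
HB.instance Definition _ :=
  GRing.SubChoice_isSubNmodule.Build _ _ submod submod_closed.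
Fact submod_addrr (x : submod) : x + x = x.
Proof. by apply: val_inj; rewrite raddfD addrr_idem. Qed.
HB.instance Definition _ := Nmodule_isBModule.Build submod submod_addrr.

Definition incl : {additive submod -> M} := val.

Section Obj.
Variable X : bmodType.

(* (f, g) belongs to F(X) when f and g have the same restriction to N. *)
Definition agree_on : {pred hom2 M X} :=
  fun u => `[< {in N, u.1 =1 u.2} >].

Record quotF := QuotF { quotF_val :> hom2 M X; _ : quotF_val \in agree_on }.
HB.instance Definition _ := [isSub for quotF_val].
HB.instance Definition _ := [Choice of quotF by <:].

Lemma agree_onP (u : hom2 M X) : reflect {in N, u.1 =1 u.2} (u \in agree_on).
Proof. exact: asboolP. Qed.

Fact agree_on_closed : GRing.nmod_closed agree_on.
Proof.
split=> [|u v /agree_onP uP /agree_onP vP]; apply/agree_onP => x xN //=.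
by rewrite uP ?vP.
Qed.
HB.instance Definition _ :=
  GRing.SubChoice_isSubNmodule.Build _ _ quotF agree_on_closed.
Fact quotF_addrr (u : quotF) : u + u = u.
Proof. by apply: val_inj; rewrite raddfD addrr_idem. Qed.
HB.instance Definition _ := Nmodule_isBModule.Build quotF quotF_addrr.
End Obj.

Section Map.
Variables (X Y : bmodType) (phi : hom2 X Y).
Fact quotF_map_subproof (u : quotF X) : hom2_comp phi u \in @agree_on Y.
Proof.
case: u => u /= /agree_onP uP; apply/agree_onP => x xN.
by rewrite /= !uP.
Qed.
Definition quotF_map (u : quotF X) : quotF Y := QuotF (quotF_map_subproof u).
Fact quotF_map_nmod_morphism : GRing.nmod_morphism quotF_map.
Proof.
split=> [|u v]; apply: val_inj; congr (_, _); apply: additive_eq => x /=;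
  by rewrite ?raddf0 ?addr0 // !raddfD addrACA.
Qed.
HB.instance Definition _ :=
  GRing.isNmodMorphism.Build _ _ quotF_map quotF_map_nmod_morphism.
End Map.

Program Definition quot_functor : functor Bmod2 Bmod := @Functor Bmod2 Bmod
  (fun X => quotF X : bmodType)
  (fun X Y phi => quotF_map phi : {additive quotF X -> quotF Y}) _ _.
Next Obligation.
move=> X; apply: additive_eq => u; apply: val_inj; exact: (@comp_idl Bmod2).
Qed.
Next Obligation.
move=> X Y Z g f; apply: additive_eq => u; apply: val_inj.
exact/esym/(@compA Bmod2).
Qed.

Definition congrF : rel (M * M) := fun p q =>
  `[< forall (X : bmodType) (u : quotF X),
        (val u).1 p.1 + (val u).2 p.2 = (val u).1 q.1 + (val u).2 q.2 >].

Fact congrF_equiv : equiv_class_of congrF.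
Proof.
split=> [p|p q|q p r].
- exact/asboolP.
- by apply/asboolP/asboolP => pq X u; rewrite pq.
- by move=> /asboolP pq /asboolP qr; apply/asboolP => X u; rewrite pq qr.
Qed.
Canonical congrF_rel := EquivRelPack congrF_equiv.

(* E / ~ with E = M * M; addition is computed on representatives, and
   [cokerp_addE] shows that it is the quotient addition. *)
Definition cokerp := {eq_quot congrF_rel}%qT.
HB.instance Definition _ := Choice.on cokerp.
HB.instance Definition _ := EqQuotient.on cokerp.

Lemma cokerp_eqP (p q : M * M) :
  reflect (forall (X : bmodType) (u : quotF X),
             (val u).1 p.1 + (val u).2 p.2 = (val u).1 q.1 + (val u).2 q.2)
          (\pi_cokerp p == \pi_cokerp q).
Proof. by rewrite (eqmodE congrF_rel); exact: asboolP. Qed.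

Definition cokerp_zero : cokerp := \pi_cokerp 0.
Definition cokerp_add (a b : cokerp) : cokerp := \pi_cokerp (repr a + repr b).

Fact cokerp_addE (p q : M * M) :
  cokerp_add (\pi_cokerp p) (\pi_cokerp q) = \pi_cokerp (p + q).
Proof.
have reprE r (X : bmodType) (u : quotF X) :
    (val u).1 (repr (\pi_cokerp r)).1 + (val u).2 (repr (\pi_cokerp r)).2
    = (val u).1 r.1 + (val u).2 r.2.
  by apply/(cokerp_eqP (repr (\pi_cokerp r)) r)/eqP; rewrite reprK.
apply/eqP/cokerp_eqP => X u.
by rewrite /= !raddfD addrACA !reprE addrACA.
Qed.

Fact cokerp_addA : associative cokerp_add.
Proof.
by move=> a b c; rewrite -[a]reprK -[b]reprK -[c]reprK !cokerp_addE addrA !reprK.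
Qed.

Fact cokerp_addC : commutative cokerp_add.
Proof. by move=> a b; rewrite /cokerp_add addrC. Qed.

Fact cokerp_add0 : left_id cokerp_zero cokerp_add.
Proof. by move=> a; rewrite -[a]reprK cokerp_addE add0r. Qed.

HB.instance Definition _ :=
  GRing.isNmodule.Build cokerp cokerp_addA cokerp_addC cokerp_add0.

Fact cokerp_addrr (a : cokerp) : a + a = a.
Proof. by rewrite -[a]reprK [LHS]cokerp_addE addrr_idem. Qed.

HB.instance Definition _ := Nmodule_isBModule.Build cokerp cokerp_addrr.

Definition cokerp_pi (p : M * M) : cokerp := \pi_cokerp p.
Fact cokerp_pi_nmod_morphism : GRing.nmod_morphism cokerp_pi.
Proof. by split=> // p q; rewrite [RHS]cokerp_addE. Qed.
HB.instance Definition _ :=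
  GRing.isNmodMorphism.Build _ _ cokerp_pi cokerp_pi_nmod_morphism.

Definition cokerp_proj : {additive M * M -> cokerp} := cokerp_pi.

End Quotient.

Section Injections.
Variable M : bmodType.
Definition inl_fun (x : M) : M * M := (x, 0).
Definition inr_fun (x : M) : M * M := (0, x).
Fact inl_nmod_morphism : GRing.nmod_morphism inl_fun.
Proof. by split=> // x y; congr (_, _); rewrite addr0. Qed.
Fact inr_nmod_morphism : GRing.nmod_morphism inr_fun.
Proof. by split=> // x y; congr (_, _); rewrite addr0. Qed.
HB.instance Definition _ :=
  GRing.isNmodMorphism.Build _ _ inl_fun inl_nmod_morphism.
HB.instance Definition _ :=
  GRing.isNmodMorphism.Build _ _ inr_fun inr_nmod_morphism.
Definition s1 : {additive M -> M * M} := inl_fun.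
Definition s2 : {additive M -> M * M} := inr_fun.
End Injections.

Arguments s1 {M}.
Arguments s2 {M}.

(* Main.v *)
(** A pair (f, g) agreeing on N induces the map (x, y) |-> f x + g y on M * M,
    which descends to Q because ~ identifies exactly the points that no such
    pair separates; conversely a map k on Q restricts along the two injections
    to such a pair.  Hence F(X) = Hom(Q, X).  An equivariant map from Q to X * X
    with the swap involution is determined by its first component, which is an
    arbitrary map Q -> X, and this gives the representation. *)
Require Import Defs.
From HB Require Import structures.
From mathcomp Require Import all_boot all_order all_algebra.

Set Implicit Arguments.
Unset Strict Implicit.
Unset Printing Implicit Defensive.

Import GRing.Theory.
Local Open Scope ring_scope.

Section Cokernel.
Variables (M : bmodType) (N : addrClosed M).

Local Notation Q := (cokerp N).
Local Notation proj := (cokerp_proj N).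

Lemma cokerp_ind (P : Q -> Prop) : (forall x y, P (proj (x, y))) -> forall a, P a.
Proof. by move=> Pp a; rewrite -[a]reprK; case: (repr a) => x y; exact: Pp. Qed.

Lemma pair_split (X Y : bmodType) (x : X) (y : Y) : (x, y) = (x, 0) + (0, y).
Proof. by congr (_, _); rewrite ?addr0 ?add0r. Qed.

(** A pair (f, g) in F(X) takes the values f x and g x on these two points, and they are equal on N,
    so no pair separates them. *)
Lemma proj_incl x : x \in N -> proj (s1 x) = proj (s2 x).
Proof.
move=> xN; apply/eqP/cokerp_eqP => X [u uP] /=; rewrite !raddf0 addr0 add0r.
by move/agree_onP: uP; apply.
Qed.

Section Lift.
Variables (X : bmodType) (u : quotF N X).

Definition lift_fun (a : Q) : X :=
  (val u).1 (repr a).1 + (val u).2 (repr a).2.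

Lemma lift_fun_proj x y : lift_fun (proj (x, y)) = (val u).1 x + (val u).2 y.
Proof.
(* The chosen representative is congruent to (x, y), and [u] is among the pairs that test the
   congruence. *)
apply: (cokerp_eqP N (repr (proj (x, y))) (x, y) _ X u).
by apply/eqP; rewrite reprK.
Qed.

Fact lift_nmod_morphism : GRing.nmod_morphism lift_fun.
Proof.
split; first by rewrite -(raddf0 proj) lift_fun_proj !raddf0 addr0.
elim/cokerp_ind=> x y; elim/cokerp_ind=> x' y'.
by rewrite -raddfD !lift_fun_proj !raddfD addrACA.
Qed.
HB.instance Definition _ :=
  GRing.isNmodMorphism.Build _ _ lift_fun lift_nmod_morphism.
Definition lift : {additive Q -> X} := lift_fun.

Lemma lift_proj x y : lift (proj (x, y)) = (val u).1 x + (val u).2 y.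
Proof. exact: lift_fun_proj. Qed.
End Lift.

Section Restrict.
Variables (X : bmodType) (h : {additive M * M -> X}).
Hypothesis h_incl : {in N, forall x, h (s1 x) = h (s2 x)}.

Fact restrict_subproof : (hom_comp h s1, hom_comp h s2) \in @agree_on M N X.
Proof. exact/agree_onP. Qed.
Definition restrict : quotF N X := QuotF restrict_subproof.

(** Additivity recovers [h] from its two restrictions, as (x, y) = (x, 0) + (0, y). *)
Lemma lift_restrict p : lift restrict (proj p) = h p.
Proof. by case: p => x y; rewrite lift_proj /= -raddfD -pair_split. Qed.
End Restrict.

(** A map equalizing the two injections on N restricts to a pair in F(Z), whose lift is the
    factorization; it is unique because [proj] is onto. *)
Lemma cokerp_is_coequalizer :
  @is_coequalizer Bmod (submod N) ((M * M)%type : bmodType) Q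
    (hom_comp s1 (incl N)) (hom_comp s2 (incl N)) proj.
Proof.
split=> [|Z h hE]; first by apply: additive_eq => -[x xN]; exact: proj_incl.
have hN : {in N, forall x, h (s1 x) = h (s2 x)}.
  by move=> x xN; have /= := congr1 (fun k : {additive _ -> _} => k (Submod xN)) hE.
exists (lift (restrict hN)); split.
  by apply: additive_eq => p; exact: lift_restrict.
move=> k kE; apply: additive_eq; elim/cokerp_ind=> x y.
by rewrite lift_restrict -kE.
Qed.

(** The swap exchanges [s1 x] and [s2 x], so the condition for descending to Q is symmetric under
    it. *)
Lemma flip_incl : {in N, forall x, hom_comp proj (flip (X := M)) (s1 x)
                                 = hom_comp proj (flip (X := M)) (s2 x)}.
Proof. by move=> x /proj_incl /esym. Qed.

Definition cokerp_sigma : {additive Q -> Q} := lift (restrict flip_incl).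

Lemma cokerp_sigmaE p : cokerp_sigma (proj p) = proj (flip p).
Proof. exact: (lift_restrict flip_incl p). Qed.

Lemma cokerp_sigmaK : involutive cokerp_sigma.
Proof. by elim/cokerp_ind=> x y; rewrite !cokerp_sigmaE. Qed.

Definition cokerp_bmods : bmods := BmodS cokerp_sigmaK.

Section Representation.
Variable X : bmodType.

(** Equivariance forces the second component of a map into X * X to be the first one precomposed
    with the involution of Q; for the lift of (f, g) this is the lift of (g, f). *)
Fact quotF_swap_subproof (u : quotF N X) :
  ((val u).2, (val u).1) \in @agree_on M N X.
Proof. by case: u => u /= /agree_onP uP; apply/agree_onP => x /uP /esym. Qed.
Definition quotF_swap (u : quotF N X) : quotF N X := QuotF (quotF_swap_subproof u).

Definition repr_fun (u : quotF N X) (a : Q) : X * X :=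
  (lift u a, lift (quotF_swap u) a).
Fact repr_fun_nmod_morphism u : GRing.nmod_morphism (repr_fun u).
Proof.
by split=> [|a b]; rewrite /repr_fun ?raddf0 // !(raddfD (lift _)).
Qed.
HB.instance Definition _ u :=
  GRing.isNmodMorphism.Build _ _ (repr_fun u) (repr_fun_nmod_morphism u).

Lemma repr_fun_proj u x y :
  repr_fun u (proj (x, y))
  = ((val u).1 x + (val u).2 y, (val u).2 x + (val u).1 y).
Proof. by rewrite /repr_fun !lift_proj. Qed.

Fact repr_subproof u :
  (repr_fun u : {additive Q -> X * X}) \in @equivariant cokerp_bmods (yB_obj X).
Proof.
apply/equivariantP; elim/cokerp_ind=> x y.
rewrite /= [cokerp_sigma _]cokerp_sigmaE !repr_fun_proj /flip /=.
by congr (_, _); rewrite addrC.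
Qed.
Definition repr_hom (u : quotF N X) : homs cokerp_bmods (yB_obj X) :=
  HomS (repr_subproof u).

Lemma repr_hom_proj u x y :
  repr_hom u (proj (x, y))
  = ((val u).1 x + (val u).2 y, (val u).2 x + (val u).1 y).
Proof. exact: repr_fun_proj. Qed.

Fact repr_hom_nmod_morphism : GRing.nmod_morphism repr_hom.
Proof.
split=> [|u v]; apply: homs_eq; elim/cokerp_ind=> x y.
  by rewrite repr_hom_proj /= !addr0.
rewrite [RHS]/= -[RHS]/(repr_hom u _ + repr_hom v _) !repr_hom_proj /=.
by congr (_, _); rewrite addrACA.
Qed.
HB.instance Definition _ :=
  GRing.isNmodMorphism.Build _ _ repr_hom repr_hom_nmod_morphism.

(** Only the first component is kept, since equivariance determines the second. *)
Definition repr_inv_hom (k : homs cokerp_bmods (yB_obj X)) : {additive M * M -> X} :=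
  fst \o (k \o proj).

Fact repr_inv_incl k : {in N, forall x, repr_inv_hom k (s1 x) = repr_inv_hom k (s2 x)}.
Proof. by move=> x xN; rewrite /= [cokerp_pi _ _]proj_incl. Qed.

Definition repr_inv k : quotF N X := restrict (repr_inv_incl k).

Fact repr_inv_nmod_morphism : GRing.nmod_morphism repr_inv.
Proof. by split=> [|k l]; apply: val_inj; congr (_, _); apply: additive_eq. Qed.
HB.instance Definition _ :=
  GRing.isNmodMorphism.Build _ _ repr_inv repr_inv_nmod_morphism.

Lemma repr_homK : cancel repr_hom repr_inv.
Proof.
move=> u; apply: val_inj; rewrite [RHS]surjective_pairing.
(* Evaluation at (x, 0) gives f x + g 0, and at (0, x) it gives f 0 + g x. *)
congr (_, _); apply: additive_eq => x /=; rewrite lift_proj raddf0.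
  exact: addr0.
exact: add0r.
Qed.

Lemma repr_invK : cancel repr_inv repr_hom.
Proof.
move=> k; apply: homs_eq => a; rewrite [RHS]surjective_pairing.
have fstE b : (repr_hom (repr_inv k) b).1 = (k b).1.
  by elim/cokerp_ind: b => x y; exact: (lift_restrict (repr_inv_incl k)).
(* Equivariance moves the second component at [a] to the first at its image under the involution,
   where [fstE] applies. *)
have sndE (l : homs cokerp_bmods (yB_obj X)) : (l a).2 = (l (cokerp_sigma a)).1.
  by rewrite (homs_equi l a).
by rewrite [LHS]surjective_pairing !sndE !fstE.
Qed.
End Representation.

Lemma quot_functor_represented :
  naturally_isomorphic (quot_functor N)
    (comp_functor (homs_functor cokerp_bmods) yB).
Proof.
exists (fun X => @repr_hom X : {additive _ -> _}); split=> [X Y phi|X].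
  apply: additive_eq => u; apply: homs_eq; elim/cokerp_ind=> x y.
  (* At the class of (x, y) each coordinate of both sides is the same sum of four terms, with the
     middle two interchanged. *)
  rewrite [RHS]repr_hom_proj [LHS]/= -[repr_fun u _]/(repr_hom u _).
  rewrite repr_hom_proj /yB_fun /= !raddfD.
  by congr (_, _); rewrite addrACA.
exists (@repr_inv X : {additive _ -> _}).
by split; apply: additive_eq; [exact: repr_homK | exact: repr_invK].
Qed.

End Cokernel.

Theorem proposition5p5 (M : bmodType) (N : addrClosed M) :
  @is_coequalizer Bmod (submod N) ((M * M)%type : bmodType) (cokerp N)
    (hom_comp s1 (incl N)) (hom_comp s2 (incl N)) (cokerp_proj N) /\
  exists (sigma : {additive cokerp N -> cokerp N}) (sigmaK : involutive sigma),
    (forall p : M * M, sigma (cokerp_proj N p) = cokerp_proj N (flip p)) /\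
    naturally_isomorphic (quot_functor N)
      (comp_functor (homs_functor (BmodS sigmaK)) yB).
Proof.
split; first exact: cokerp_is_coequalizer.
exists (cokerp_sigma N), (@cokerp_sigmaK M N).
split; [exact: cokerp_sigmaE | exact: quot_functor_represented].
Qed.
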